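(* Let $K$ be an algebraically closed field of characteristic $p=0$, let $C\subset\mathbb{P}^2$ be an irreducible plane curve over $K$ of degree $d\ge 4$, and assume that $P=(1:0:0)$ is extendable quasi-Galois for $C$ with $|G_0[P]|=n\ge 2$. Then $C$ is given by $f(x^n,y)=0$ in the affine plane $Z\ne 0$ for some polynomial $f(X,y)$. Let $r$ be the degree of $f(X,y)$ in the variable $X$, and let $R$ be the degree of the Galois closure of $K(X,y)/K(y)$. Then $$n\times r\le |G_P|\le R\times n^r.$$ In particular, $$n\le |G_P|\le r!\times n^r.$$
   Context: $(X:Y:Z)$ are homogeneous coordinates on $\mathbb{P}^2$, with affine coordinates $x=X/Z$, $y=Y/Z$ on the open set $Z\ne 0$. In $f(X,y)$ and $K(X,y)$ the letter $X$ denotes the first variable of the polynomial $f$, for which $x^n$ is substituted; $K(X,y)$ is the function field of the curve $f(X,y)=0$, that is, the subfield $K(x^n,y)$ of $K(C)=K(x,y)$. $\pi_P:C\dashrightarrow\mathbb{P}^1$ is the projection from $P$, $Q\mapsto\overline{PQ}$. $G[P]=\{\tau\in\mathrm{Bir}(C)\mid \pi_P\circ\tau=\pi_P\}$ is the group of birational transformations of $C$ preserving the fibers of $\pi_P$, and $G_0[P]\subset G[P]$ is the set of all elements of $G[P]$ which are restrictions to $C$ of linear transformations of $\mathbb{P}^2$. The point $P$ is called extendable quasi-Galois if $|G_0[P]|\ge 2$. $L_P$ denotes the Galois closure of the field extension $K(C)/\pi_P^*K(\mathbb{P}^1)$, and $G_P=\mathrm{Gal}(L_P/\pi_P^*K(\mathbb{P}^1))$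 is its Galois group.
   Formalization: As stated, f(x^n,y)=0 can fail, e.g. for (X+Y)^4+Y^4+Z^4=0 with n=4; the formal theorem replaces x by x1=x+by+c for some b,c in K, in the equation and in K(X,y)=K(x1^n,y), and proves the bounds for every such b,c,f, including b=c=0. *)

(* Defs.v *)
From HB Require Import structures.
From mathcomp Require Import all_boot all_order all_algebra all_fingroup all_field.
From mathcomp Require Import mpoly.
From mathcomp Require Import boolp classical_sets functions cardinality.

Set Implicit Arguments.
Unset Strict Implicit.
Unset Printing Implicit Defensive.

Import GRing.Theory.
Local Open Scope ring_scope.

(* The plane curve C is represented by its equation, a form F(X,Y,Z) in
   {mpoly K[3]} (variables 0, 1, 2 are X, Y, Z); P is (1:0:0), so that pi_P is
   (X:Y:Z) |-> (Y:Z). *)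

Section Curve.
Variable K : fieldType.

Definition irreducible_mpoly (m : nat) (F : {mpoly K[m]}) : Prop :=
  [/\ F != 0, F \isn't a GRing.unit &
      forall G H : {mpoly K[m]}, F = G * H ->
        G \is a GRing.unit \/ H \is a GRing.unit].

Definition plane_curve (d : nat) (F : {mpoly K[3]}) : Prop :=
  F \is d.-homog /\ irreducible_mpoly F.

Definition triple (S : Type) (a b c : S) (i : 'I_3) : S :=
  tnth [tuple a; b; c] i.

(* F(x,y,1), as a polynomial in x with coefficients in K[y]. *)
Definition dehomog (F : {mpoly K[3]}) : {poly {poly K}} :=
  mmap (fun k : K => (k%:P)%:P) (triple 'X ('X)%:P 1) F.

(* C is given by f(x1^n, y) = 0 in the affine plane Z != 0, in the affine
   coordinates (x1, y) with x1 = x + b y + c. The outer variable of f is X,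
   the inner one is y; an equation is determined up to a nonzero constant.
   The coordinate x1 is needed since fixing P = (1:0:0) does not force the
   common axis of the homologies in G_0[P] to be the line X = 0. *)
Definition given_by (F : {mpoly K[3]}) (b c : K) (n : nat)
    (f : {poly {poly K}}) : Prop :=
  exists2 e : K, e != 0 &
    dehomog F = (e%:P)%:P * (f \Po ('X + (b *: 'X + c%:P)%:P) ^+ n).

(* The function field K(P^1) of the target of pi_P, in the coordinate
   y = Y/Z. *)
Definition KP1 : fieldType := {fraction {poly K}}.

Definition yP1 : KP1 := FracField.tofrac ('X : {poly K}).
Definition cstP1 (k : K) : KP1 := FracField.tofrac (k%:P : {poly K}).

Section FunctionField.
(* Every extension of K(P^1) is regarded as a field extension via pi_P^*, so
   that a%:A is pi_P^* a for a in K(P^1). *)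
Variables (M : fieldExtType KP1) (x : M).

(* (x:y:1) is the generic point of C: the forms that vanish at it are the
   multiples of F. The field <<1; x>> = K(y)(x) generated by its coordinates
   is then the function field K(C). *)
Definition generic_point (F : {mpoly K[3]}) : Prop :=
  forall (e : nat) (G : {mpoly K[3]}), G \is e.-homog ->
    (mmap (fun k : K => (cstP1 k)%:A) (triple x yP1%:A 1) G = 0 <->
     exists H : {mpoly K[3]}, G = H * F).

Definition KC : {subfield M} := <<1; x>>%AS.

Definition KCtype : fieldExtType KP1 := subvs_of KC.

Definition cstC (k : K) : KCtype := (cstP1 k)%:A.

Definition hcoordC : 'I_3 -> KCtype :=
  triple (vsproj KC x) (yP1%:A) 1.

(* A birational transformation tau of C is represented by its pullback tau^*,
   a K-automorphism of K(C). *)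
Definition BirC : set (KCtype -> KCtype) :=
  [set t : KCtype -> KCtype | exists s : {rmorphism KCtype -> KCtype},
     [/\ t = s :> (KCtype -> KCtype), bijective t & forall k, t (cstC k) = cstC k]]%classic.

(* G[P]: pi_P \o tau = pi_P, that is, tau^* \o pi_P^* = pi_P^*. *)
Definition GP_bir : set (KCtype -> KCtype) :=
  [set t : KCtype -> KCtype | BirC t /\ forall a : KP1, t a%:A = a%:A]%classic.

(* tau is the restriction to C of a linear transformation A of P^2: its image
   of the generic point, a K(C)-point of P^2, is the image under A. *)
Definition linear_on_C (t : KCtype -> KCtype) : Prop :=
  exists2 A : 'M[K]_3, A \in unitmx &
  exists2 l : KCtype, l != 0 &
    forall i, t (hcoordC i) = l * \sum_(j < 3) cstC (A i j) * hcoordC j.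

(* G_0[P] *)
Definition G0P : set (KCtype -> KCtype) :=
  [set t : KCtype -> KCtype | GP_bir t /\ linear_on_C t]%classic.

(* The affine coordinate x1 = x + b y + c as an element of K(C). *)
Definition xcoord (b c : K) : M :=
  x + (cstP1 b * yP1 + cstP1 c)%:A.

(* K(x1^n, y) *)
Definition KXy (b c : K) (n : nat) : {subfield M} :=
  <<1; xcoord b c ^+ n>>%AS.

End FunctionField.
End Curve.

Arguments cstC {K M} x k.
Arguments BirC {K M} x _.
Arguments GP_bir {K M} x _.
Arguments G0P {K M} x _.

(* N is the Galois closure of E / F0, formed inside M: F0 is the subfield 1 of
   M, and degrees and dimensions are over F0. *)
Definition is_galois_closure (F0 : fieldType) (M : splittingFieldType F0)
    (E N : {subfield M}) : Prop :=
  [/\ galois 1 N, (E <= N)%VS &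
      forall N' : {subfield M}, galois 1 N' -> (E <= N')%VS -> (N <= N')%VS].

(* Main.v *)
(* Every tau in G_0[P] acts on the generic point by x |-> a x + q(y) with a in
   K and q affine: otherwise the generic point would lie on a conic, while
   d > 2.  In characteristic 0 averaging the q's over G_0[P] exhibits a common
   axis x1 = 0, so that tau x1 = a x1; hence the n values of a are distinct and
   form the group of n-th roots of unity, and the equation of C, being
   semi-invariant under x1 |-> zeta x1, is a polynomial in x1^n.

   For the bounds, [K(C) : K(y)] = n r is a lower bound.  For the upper bound,
   the closure N of K(x1^n, y) contains the at most r conjugates of x1^n, and
   K contains the n-th roots of unity, so adjoining to N one n-th root of each
   conjugate, of degree at most n each time, yields a field containing L_P. *)
From HB Require Import structures.
Require Import Defs.
From mathcomp Require Import all_boot all_order all_algebra all_fingroup all_field.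
From mathcomp Require Import generic_quotient cyclic.
From mathcomp Require Import mpoly ring.
From mathcomp Require Import boolp classical_sets functions cardinality.
Set Implicit Arguments.
Unset Strict Implicit.
Unset Printing Implicit Defensive.
Import GRing.Theory.
Local Open Scope ring_scope.

(** * Clearing denominators in fractions and in polynomials over them *)

Lemma fraction_numden (R : idomainType) (z : {fraction R}) :
  exists2 b, b != 0 & exists a, FracField.tofrac b * z = FracField.tofrac a.
Proof.
elim/quotW: z => r; exists (\d_r); first exact: denom_ratioP.
exists (\n_r); unlock FracField.tofrac.
rewrite -[LHS]FracField.pi_mul; apply/eqmodP.
have r0 := denom_ratioP r.
rewrite /= FracField.equivfE /FracField.mulf.
by rewrite !numden_Ratio ?oner_eq0 ?mul1r ?mulr1 // mulrC.
Qed.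

Lemma poly_fraction_numden (R : idomainType) (q : {poly {fraction R}}) :
  exists2 b, b != 0 &
    exists g, FracField.tofrac b *: q = map_poly (@FracField.tofrac R) g.
Proof.
elim/poly_ind: q => [|q z [b b0 [g eg]]].
  by exists 1; rewrite ?oner_eq0 //; exists 0; rewrite rmorph0 scaler0.
have [e e0 [a ea]] := fraction_numden z.
exists (b * e); first by rewrite mulf_neq0.
exists (e *: g * 'X + (b * a)%:P).
rewrite rmorphM /= rmorphD /= (rmorphM _ (e *: g)) /= map_polyZ /= map_polyX.
rewrite map_polyC /= -eg rmorphM /= -ea -!mul_polyC !polyCM.
ring.
Qed.

(** * Degrees of extensions generated by roots and radicals *)

Section FieldExtensions.
Variables (F0 : fieldType) (L : fieldExtType F0).
Implicit Types (E : {subfield L}) (x : L) (rs : seq L).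

Lemma dim_Fadjoin_root E x (p : {poly L}) :
  p \is a polyOver E -> p != 0 -> root p x ->
  (\dim <<E; x>> <= (size p).-1 * \dim E)%N.
Proof.
move=> pE p0 px; rewrite dim_Fadjoin leq_mul2r; apply/orP; right.
have := dvdp_leq p0 (minPoly_dvdp pE px).
by rewrite size_minPoly; case: (size p).
Qed.

(** Once a root is adjoined, its linear factor can be divided out over the larger field, so the
    successive degrees are bounded by factors that drop by one each time. *)
Lemma dim_Fadjoin_seq_fact E rs :
  \prod_(a <- rs) ('X - a%:P) \is a polyOver E ->
  (\dim <<E & rs>> <= (size rs)`! * \dim E)%N.
Proof.
elim: rs E => [|a rs IHrs] E; first by rewrite Fadjoin_nil mul1n.
rewrite big_cons adjoin_cons => pE.
have Xa : ('X - a%:P) \is a polyOver <<E; a>>%AS.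
  by rewrite polyOverXsubC memv_adjoin.
have pEa : \prod_(b <- rs) ('X - b%:P) \is a polyOver <<E; a>>%AS.
  have X0 : 'X - a%:P != 0 by rewrite polyXsubC_eq0.
  rewrite -(mulKp (\prod_(b <- rs) ('X - b%:P)) X0) divp_polyOver //.
  by apply: polyOverS pE; apply/subvP/subv_adjoin.
apply: leq_trans (IHrs _ pEa) _; rewrite factS mulnAC.
rewrite [X in (_ <= X)%N]mulnC leq_mul2l.
apply/orP; right.
have p0 : ('X - a%:P) * \prod_(b <- rs) ('X - b%:P) != 0.
  by rewrite mulf_neq0 ?polyXsubC_eq0 // monic_neq0 // monic_prod_XsubC.
have := dim_Fadjoin_root (x := a) pE p0; rewrite rootM root_XsubC eqxx => /(_ isT).
by rewrite -(big_cons _ _ a rs xpredT (fun b => 'X - b%:P)) size_prod_XsubC.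
Qed.

(** Each [v] is a root of ['X^n - (v ^+ n)%:P] over the field reached so far, so each adjunction
    costs a factor of at most [n]. *)
Lemma dim_Fadjoin_radicals (n : nat) E rs :
  (0 < n)%N -> (forall v, v \in rs -> v ^+ n \in E) ->
  (\dim <<E & rs>> <= \dim E * n ^ size rs)%N.
Proof.
move=> n0; elim: rs E => [|v rs IHrs] E vE.
  by rewrite Fadjoin_nil muln1.
rewrite adjoin_cons.
have /IHrs : forall w, w \in rs -> w ^+ n \in <<E; v>>%AS.
  by move=> w wrs; apply: subvP_adjoin; apply: vE; rewrite inE wrs orbT.
move=> /leq_trans; apply; rewrite expnS mulnA leq_mul2r; apply/orP; right.
have pE : 'X^n - (v ^+ n)%:P \is a polyOver E.
  by rewrite rpredB ?rpredX ?polyOverX // polyOverC vE // mem_head.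
have := dim_Fadjoin_root pE.
rewrite -size_poly_eq0 size_XnsubC // => /(_ v isT) /=.
by rewrite mulnC; apply; rewrite rootE !hornerE subrr.
Qed.

End FieldExtensions.

(** ['X^n - 1] splits over [K], so every n-th root of unity of [L], in particular [a / v] for
    nonzero [v], comes from [K]. *)
Lemma root_XnsubC_closed (K : closedFieldType) (L : fieldType)
    (phi : {rmorphism K -> L}) (n : nat) (a v : L) :
  (0 < n)%N -> a ^+ n = v ^+ n -> exists k, a = phi k * v.
Proof.
move=> n0 e; have [v0|v0] := eqVneq v 0.
  move: e; rewrite v0 expr0n eqn0Ngt n0 => /eqP; rewrite expf_eq0 n0 => /eqP->.
  by exists 0; rewrite mulr0.
have [rs ers] := closed_field_poly_normal ('X^n - 1 : {poly K}).
have : root (map_poly phi ('X^n - 1)) (a / v).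
  rewrite rmorphB rmorph1 /= map_polyXn rootE !hornerE expr_div_n e.
  by rewrite divff ?subrr // expf_neq0.
rewrite ers (monicP (monic_Xn_sub_1 _ n0)) // scale1r rmorph_prod /=.
under eq_bigr do rewrite rmorphB /= map_polyX map_polyC.
rewrite -(big_map phi xpredT (fun b => 'X - b%:P)) root_prod_XsubC.
by case/mapP => k _ ek; exists k; rewrite -ek divfK.
Qed.

(** * Galois closures of simple extensions in characteristic 0 *)

Section SplittingFields.
Variables (F0 : fieldType) (L : splittingFieldType F0).
Hypothesis charL : [pchar L] =i pred0.
Implicit Types (E N : {subfield L}) (x u : L).

Lemma galois_splitting_minPoly x rs :
  minPoly 1 x = \prod_(a <- rs) ('X - a%:P) -> galois 1 <<1 & rs>>.
Proof.
move=> ers; apply/splitting_galoisField; exists (minPoly 1 x).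
split; [exact: minPolyOver | exact: pcharf0_separable |].
by exists rs; rewrite // ers eqpxx.
Qed.

(** Minimality of [N] against the splitting field of [minPoly 1 x] gives the inclusion; normality of
    [N], which contains [x], puts the conjugates of [x] in [N]. *)
Lemma galois_closure_min x E N :
  is_galois_closure E N -> E = <<1; x>>%AS ->
  exists2 rs, minPoly 1 x = \prod_(a <- rs) ('X - a%:P) &
    (N <= <<1 & rs>>)%VS /\ {subset rs <= N}.
Proof.
case=> gN EN minN eE.
have [rs /eqP ers] := splitting_field_normal 1%AS x.
exists rs => //; split.
  apply: (minN <<1 & rs>>%AS); first exact: galois_splitting_minPoly ers.
  rewrite eE; apply/FadjoinP; split; first exact: sub1v.
  apply: seqv_sub_adjoin; rewrite -root_prod_XsubC -ers; exact: root_minPoly.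
have xN : x \in N by apply: (subvP EN); rewrite eE memv_adjoin.
case/and3P: gN => _ _ /normalFieldP/(_ x xN) [rs' /allP sN].
rewrite ers => e a; rewrite -root_prod_XsubC e root_prod_XsubC; exact: sN.
Qed.

Lemma dim_galois_closure_fact u E N :
  is_galois_closure E N -> E = <<1; u>>%AS ->
  (\dim N <= (\dim E)`!)%N.
Proof.
move=> cl eE; have [rs ers [sN _]] := galois_closure_min cl eE.
apply: leq_trans (dimvS sN) _.
have := @dim_Fadjoin_seq_fact _ _ 1%AS rs.
rewrite -ers minPolyOver dimv1 muln1 => /(_ isT) /leq_trans; apply.
rewrite eE /= dim_Fadjoin dimv1 muln1.
have := size_prod_XsubC rs id; rewrite -ers size_minPoly => -[->].
exact: leqnn.
Qed.

(* Conjugates of x have n-th powers among the conjugates of x ^+ n, and two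
   n-th roots of the same element differ by a constant from K; so one n-th
   root of each conjugate of x ^+ n suffices to generate the closure. *)
Lemma dim_galois_closure_radical (K : closedFieldType)
    (phi : {rmorphism K -> L}) (n : nat) x E N N' :
  (0 < n)%N -> (forall k, phi k \in 1%VS) ->
  is_galois_closure E N -> E = <<1; x>>%AS ->
  is_galois_closure <<1; x ^+ n>>%AS N' ->
  (\dim N <= \dim N' * n ^ \dim <<1; x ^+ n>>)%N.
Proof.
move=> n0 phi1 cl eE cl'.
have [rs ers [sN _]] := galois_closure_min cl eE.
have [us eus [_ usN']] := galois_closure_min cl' erefl.
(* A conjugate of [x] that is an n-th root of [w], if there is one; the default 0 is harmless, since
   its n-th power 0 lies in [N']. *)
pose v w := head 0 [seq a <- rs | a ^+ n == w].
have vE w : w \in N' -> v w ^+ n \in N'.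
  move=> wN; rewrite /v; have : all (fun a => a ^+ n == w) [seq a <- rs | a ^+ n == w].
    exact: filter_all.
  by case: filter => [|a s] /= => [_|/andP[/eqP-> //]];
    rewrite expr0n eqn0Ngt n0 rpred0.
pose vs := map v us.
have sub : (<<1 & rs>> <= <<N' & vs>>)%VS.
  apply/Fadjoin_seqP; split; first exact: sub1v.
  move=> a ars; have anus : a ^+ n \in us.
    (* A root of the composite is exactly an element whose n-th power is conjugate to [x ^+ n]. *)
    have : minPoly 1 x %| minPoly 1 (x ^+ n) \Po 'X^n.
      apply: minPoly_dvdp.
        by rewrite polyOver_comp ?minPolyOver ?rpredX ?polyOverX.
      by rewrite root_comp hornerXn root_minPoly.
    have ax : 'X - a%:P %| minPoly 1 x by rewrite dvdp_XsubCl ers root_prod_XsubC.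
    by move/(dvdp_trans ax); rewrite dvdp_XsubCl root_comp hornerXn eus root_prod_XsubC.
  have ev : a ^+ n = v (a ^+ n) ^+ n.
    rewrite /v; have : all (fun b => b ^+ n == a ^+ n) [seq b <- rs | b ^+ n == a ^+ n].
      exact: filter_all.
    have : a \in [seq b <- rs | b ^+ n == a ^+ n] by rewrite mem_filter eqxx.
    by case: filter => [//|b s] _ /= /andP[/eqP-> _].
  have [k ->] := root_XnsubC_closed phi n0 ev.
  apply: rpredM; last by apply: seqv_sub_adjoin; apply: map_f.
  by apply: (subvP (sub1v _)).
apply: leq_trans (dimvS sN) _; apply: leq_trans (dimvS sub) _.
apply: leq_trans (dim_Fadjoin_radicals (n := n) (E := N') (rs := vs) n0 _) _.
  by move=> w /mapP[u /usN' uN ->]; apply: vE.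
rewrite dim_Fadjoin dimv1 muln1 size_map.
by have := size_prod_XsubC us id; rewrite -eus size_minPoly => -[->].
Qed.

End SplittingFields.

(** * Passing between forms and affine equations *)

Lemma rmorph_mmap (m : nat) (R S T : comNzRingType) (phi : {rmorphism S -> T})
    (f : R -> S) (h : 'I_m -> S) (p : {mpoly R[m]}) :
  phi (mmap f h p) = mmap (phi \o f) (phi \o h) p.
Proof.
rewrite /mmap rmorph_sum; apply: eq_bigr => i _.
rewrite rmorphM /= /mmap1 rmorph_prod; congr (_ * _).
by apply: eq_bigr => j _; rewrite rmorphXn.
Qed.

Section Dehomogenization.
Variable K : fieldType.

HB.instance Definition _ := GRing.RMorphism.copy (@dehomog K)
  (mmap (@polyC {poly K} \o @polyC K) (triple 'X ('X)%:P 1)).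

Lemma dehomogX i : dehomog ('X_i : {mpoly K[3]}) = triple 'X ('X)%:P 1 i.
Proof. by rewrite /dehomog -[LHS]/(mmap (polyC \o polyC) _ _) mmapX mmap1U. Qed.

Lemma dehomogZ k (G : {mpoly K[3]}) : dehomog (k *: G) = (k%:P)%:P * dehomog G.
Proof. by rewrite /dehomog -[LHS]/(mmap (polyC \o polyC) _ _) mmapZ. Qed.

(** The exponent of Z is a truncated subtraction: the result is a form of degree [e] when [e] bounds
    the total degree of [g], while setting Z = 1 recovers [g] for every [e]. *)
Definition homogenize (e : nat) (g : {poly {poly K}}) : {mpoly K[3]} :=
  \sum_(i < size g) \sum_(j < size (g`_i)) g`_i`_j *:
    ('X_0 ^+ i * 'X_1 ^+ j * 'X_(inord 2) ^+ (e - (i + j))).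

Lemma dehomog_homogenize e g : dehomog (homogenize e g) = g.
Proof.
rewrite /homogenize rmorph_sum /= -[RHS]coefK poly_def; apply: eq_bigr => i _.
rewrite rmorph_sum /= -[in RHS](coefK g`_i) poly_def -mul_polyC rmorph_sum mulr_suml.
apply: eq_bigr => j _; rewrite dehomogZ !rmorphM !rmorphXn /= !dehomogX.
rewrite /triple !(tnth_nth 0) /= inordK //= expr1n mulr1.
by rewrite -mul_polyC rmorphM rmorphXn /= -mulrA; congr (_ * _); rewrite mulrC.
Qed.

Lemma dhomog_homogenize e (g : {poly {poly K}}) :
  (forall i j, (i < size g)%N -> (j < size (g`_i)%R)%N -> (i + j <= e)%N) ->
  homogenize e g \is e.-homog.
Proof.
move=> le_e; apply: rpred_sum => i _; apply: rpred_sum => j _; apply: rpredZ.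
have Xm k m : ('X_k ^+ m : {mpoly K[3]}) \is m.-homog.
  by rewrite -{2}(mul1n m); apply: dhomogMn; rewrite dhomogX /= mdeg1.
rewrite -{2}(subnKC (le_e i j (ltn_ord i) (ltn_ord j))).
by do 2?apply: dhomogM; apply: Xm.
Qed.

Lemma homogenizable (g : {poly {poly K}}) : exists2 G : {mpoly K[3]},
  (exists e, G \is e.-homog) & dehomog G = g.
Proof.
(* A crude bound on the total degree of [g] in both variables. *)
pose e := (size g + \max_(i < size g) size (g`_i)%R)%N.
exists (homogenize e g); last exact: dehomog_homogenize.
exists e; apply: dhomog_homogenize => i j li lj; apply: leq_add; first exact: ltnW.
apply: ltnW; apply: leq_trans lj _.
exact: (@leq_bigmax_cond _ xpredT (fun i : 'I_(size g) => size (g`_i)) (Ordinal li)).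
Qed.

End Dehomogenization.

(** * Relations satisfied by the generic point *)

Section GenericPoint.
Variables (K : fieldType) (M : fieldExtType (KP1 K)) (x : M) (F : {mpoly K[3]}).

(** Evaluation at the generic point. Writing it as a composite of ring morphisms lets it inherit
    their structure. *)
Definition evalxy : {poly {poly K}} -> M :=
  horner_eval x \o map_poly (GRing.in_alg M \o @FracField.tofrac {poly K}).

HB.instance Definition _ := GRing.RMorphism.on evalxy.

Lemma evalxyE g :
  evalxy g = (map_poly (GRing.in_alg M \o @FracField.tofrac {poly K}) g).[x].
Proof. by []. Qed.

Lemma evalxy_dehomog (G : {mpoly K[3]}) :
  evalxy (dehomog G) = mmap (fun k => (cstP1 k)%:A) (triple x (yP1 K)%:A 1) G.
Proof.
rewrite /dehomog rmorph_mmap; congr mmap.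
  by apply: funext => k; rewrite /= evalxyE map_polyC hornerC.
apply: funext => i; rewrite /= evalxyE /triple !(tnth_nth 0).
case: i => [[|[|[|//]]] ?] /=.
- by rewrite map_polyX hornerX.
- by rewrite map_polyC hornerC.
- by rewrite rmorph1 hornerC.
Qed.

Hypothesis genF : generic_point x F.

(** [generic_point] speaks of forms only, so [g] is homogenized first and the cofactor of [F] is
    then dehomogenized. *)
Lemma evalxy_eq0 g : evalxy g = 0 -> exists h, g = h * dehomog F.
Proof.
have [G [e Ge] <-] := homogenizable g.
rewrite evalxy_dehomog => /(genF Ge)[H ->].
by exists (dehomog H); rewrite rmorphM.
Qed.

Lemma evalxy_dehomog0 d : F \is d.-homog -> evalxy (dehomog F) = 0.
Proof.
by move=> Fd; rewrite evalxy_dehomog; apply/(genF Fd); exists 1; rewrite mul1r.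
Qed.

Lemma evalxy_size g : evalxy g = 0 -> g != 0 -> (size (dehomog F) <= size g)%N.
Proof.
move=> /evalxy_eq0[h ->]; rewrite mulf_eq0 negb_or => /andP[h0 F0].
by rewrite size_mul // -subn1 -addnBAC ?leq_addl // size_poly_gt0.
Qed.

(** The witness is the minimal polynomial of [x] over K(y), with denominators cleared. *)
Lemma exists_evalxy0 : exists2 g, g != 0 & evalxy g = 0 /\ size g = size (minPoly 1 x).
Proof.
have /polyOver1P[q eq] := minPolyOver 1 x.
have [b b0 [g eg]] := poly_fraction_numden q.
have q0 : q != 0.
  by apply: contraTneq (monic_minPoly 1 x) => q0;
    rewrite eq q0 rmorph0 monicE lead_coef0 eq_sym oner_eq0.
have tb0 : FracField.tofrac b != 0 by rewrite tofrac_eq0.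
have sg : size g = size q.
  rewrite -(size_scale q tb0) eg size_map_inj_poly ?rmorph0 //.
  by move=> u v /eqP; rewrite tofrac_eq => /eqP.
exists g; first by rewrite -size_poly_eq0 sg size_poly_eq0.
split; last by rewrite sg eq size_map_poly.
rewrite evalxyE map_poly_comp -eg map_polyZ hornerZ -eq.
by have /eqP-> := root_minPoly 1 x; rewrite mulr0.
Qed.

Lemma dehomog_neq0 : dehomog F != 0.
Proof.
have [g g0 [/evalxy_eq0[h eg] _]] := exists_evalxy0.
by apply: contraNneq g0 => F0; rewrite eg F0 mulr0.
Qed.

(** The minimal polynomial of [x], cleared of denominators, is a multiple of the equation, which
    bounds the degree below; the equation itself vanishes at [x], which bounds it above. *)
Lemma dim_KC d : F \is d.-homog -> \dim (KC x) = (size (dehomog F)).-1.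
Proof.
move=> Fd; rewrite dim_Fadjoin dimv1 muln1; apply/eqP; rewrite eqn_leq.
have [g g0 [gx sg]] := exists_evalxy0.
have -> : adjoin_degree 1 x = (size g).-1 by rewrite sg size_minPoly.
apply/andP; split; last by rewrite -!subn1 leq_sub2r // evalxy_size.
pose p := map_poly (GRing.in_alg M \o @FracField.tofrac {poly K}) (dehomog F).
have p1 : p \is a polyOver 1%VS.
  by apply/polyOver1P; rewrite /p; eexists; rewrite map_poly_comp.
have sp : size p = size (dehomog F).
  rewrite size_map_inj_poly ?rmorph0 // => u v /(fmorph_inj (GRing.in_alg M))/eqP.
  by rewrite tofrac_eq => /eqP.
have p0 : p != 0 by rewrite -size_poly_eq0 sp size_poly_eq0 dehomog_neq0.
have px : root p x by rewrite rootE -evalxyE (evalxy_dehomog0 Fd).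
by rewrite sg -sp -!subn1 leq_sub2r // dvdp_leq // minPoly_dvdp.
Qed.

(** A nonzero multiple of [F] has degree at least [d], as the degrees of leading monomials add. *)
Lemma generic_form_eq0 d e G : F \is d.-homog -> G \is e.-homog -> (e < d)%N ->
  evalxy (dehomog G) = 0 -> G = 0.
Proof.
move=> Fd Ge ed; rewrite evalxy_dehomog => /(genF Ge)[H eG].
have [H0|H0] := eqVneq H 0; first by rewrite eG H0 mul0r.
have F0 : F != 0 by apply: contraNneq dehomog_neq0 => ->; rewrite rmorph0.
have G0 : G != 0 by rewrite eG mulf_neq0.
have /dhomogP/(_ _ (mlead_supp F0)) /= dF := Fd.
have /dhomogP/(_ _ (mlead_supp G0)) /= := Ge.
rewrite eG mleadM // mdegD dF => e'.
by move: ed; rewrite -e' ltnNge leq_addl.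
Qed.

End GenericPoint.

(** * Degrees of the function fields and bounds on |G_P| *)

Section Degrees.
Variables (K : closedFieldType) (M : splittingFieldType (KP1 K)) (x : M).
Variable F : {mpoly K[3]}.

Lemma xcoordE b c :
  xcoord x b c = x + (FracField.tofrac (b *: 'X + c%:P))%:A.
Proof. by rewrite /xcoord /cstP1 /yP1 rmorphD -mul_polyC rmorphM. Qed.

Lemma KC_xcoord b c : KC x = <<1; xcoord x b c>>%AS.
Proof.
set z := xcoord x b c.
have zx : z - x \in 1%VS by rewrite /z xcoordE addrC addKr memvZ ?mem1v.
have sub (E : {subfield M}) : z - x \in E.
  by apply: subvP zx; apply: sub1v.
apply/val_inj/eqP; rewrite eqEsubv; apply/andP; split; apply/FadjoinP; split;
  rewrite ?sub1v //.
  by rewrite -[x](subKr z) rpredB ?sub ?memv_adjoin.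
by rewrite -[z](subrK x) rpredD ?sub ?memv_adjoin.
Qed.

Lemma size_given_by n b c f : given_by F b c n f ->
  (size (dehomog F)).-1 = (n * (size f).-1)%N.
Proof.
case=> e e0 ->; rewrite mul_polyC size_scale ?polyC_eq0 // size_comp_poly.
by rewrite size_exp size_XaddC mul1n mulnC.
Qed.

(** Since F vanishes at the generic point and [e] is a nonzero constant, [f], read over K(y), is a
    nonzero polynomial that kills [xcoord x b c ^+ n]. *)
Lemma dim_KXy n b c f d : generic_point x F -> F \is d.-homog ->
  given_by F b c n f -> (\dim (KXy x b c n) <= (size f).-1)%N.
Proof.
move=> genF Fd gF.
pose p := map_poly (GRing.in_alg M \o @FracField.tofrac {poly K}) f.
have f0 : f != 0.
  apply: contraNneq (dehomog_neq0 genF) => f0.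
  by have [e _ ->] := gF; rewrite f0 comp_poly0 mulr0.
have sp : size p = size f.
  rewrite size_map_inj_poly ?rmorph0 // => u v /(fmorph_inj (GRing.in_alg M))/eqP.
  by rewrite tofrac_eq => /eqP.
have p1 : p \is a polyOver 1%VS.
  by apply/polyOver1P; rewrite /p; eexists; rewrite map_poly_comp.
have p0 : p != 0 by rewrite -size_poly_eq0 sp size_poly_eq0.
rewrite -sp; have := @dim_Fadjoin_root _ _ 1%AS (xcoord x b c ^+ n) p p1 p0.
rewrite dimv1 muln1; apply.
have [e e0 eF] := gF; have := evalxy_dehomog0 genF Fd.
rewrite evalxyE eF rmorphM /= map_comp_poly hornerM horner_comp => /eqP.
rewrite mulf_eq0 map_polyC hornerC /= scaler_eq0 oner_eq0 orbF tofrac_eq0.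
rewrite polyC_eq0 (negPf e0) rmorphXn rmorphD /= map_polyX map_polyC /=.
by rewrite horner_exp hornerD hornerX hornerC -xcoordE.
Qed.

End Degrees.

Lemma degree_bounds (K : closedFieldType) (d n : nat) (F : {mpoly K[3]})
    (M : splittingFieldType (KP1 K)) (x : M) (LP : {subfield M})
    (b c : K) (f : {poly {poly K}}) (N : {subfield M}) :
  [pchar K] =i pred0 -> F \is d.-homog -> generic_point x F -> (0 < n)%N ->
  is_galois_closure (KC x) LP -> given_by F b c n f ->
  is_galois_closure (KXy x b c n) N ->
  [/\ (0 < (size f).-1)%N, (\dim N <= ((size f).-1)`!)%N &
    (n * (size f).-1 <= #|'Gal(LP / 1)%g| <= \dim N * n ^ (size f).-1)%N].
Proof.
move=> charK Fd genF n0 clL gF clN.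
have charM : [pchar M] =i pred0.
  move=> p; rewrite -(charK p).
  pose phi := GRing.in_alg M \o @FracField.tofrac {poly K} \o @polyC K.
  exact: (fmorph_pchar phi).
have dimK : \dim (KC x) = (n * (size f).-1)%N.
  by rewrite (dim_KC genF Fd) (size_given_by gF).
have r0 : (0 < (size f).-1)%N.
  by have := adim_gt0 (KC x); rewrite dimK muln_gt0 => /andP[].
have dimu := dim_KXy genF Fd gF.
have [gL KL _] := clL.
(* The order of the Galois group becomes the dimension of [LP]. *)
rewrite -(galois_dim gL) dimv1 divn1; split=> //.
  apply: leq_trans (dim_galois_closure_fact charM clN erefl) _.
  exact: leq_fact.
rewrite -dimK dimvS //=.
pose phi := GRing.in_alg M \o @FracField.tofrac {poly K} \o @polyC K.
have phi1 k : phi k \in 1%VS by rewrite memvZ ?mem1v.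
(* K(C) must be generated here by x1 instead of [x], since it is the n-th power of x1 that generates
   [KXy]. *)
have := dim_galois_closure_radical charM n0 phi1 clL (KC_xcoord x b c) clN.
move=> /leq_trans; apply; rewrite leq_mul2l leq_pexp2l ?orbT //.
Qed.

(** * Elements of G_0[P] as affine substitutions in x *)

Section Homologies.
Variables (K : fieldType) (M : fieldExtType (KP1 K)) (x : M) (F : {mpoly K[3]}).
Variable d : nat.
Hypotheses (genF : generic_point x F) (Fd : F \is d.-homog) (d3 : (2 < d)%N).

Local Notation emb := (GRing.in_alg M \o @FracField.tofrac {poly K}).
Local Notation vx := (vsproj (KC x) x : KCtype x).

Lemma val_vx : vsval vx = x.
Proof. by rewrite vsprojK // memv_adjoin. Qed.

Definition linear_form (v : 'I_3 -> K) : {mpoly K[3]} := \sum_j v j *: 'X_j.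

Lemma linear_form_homog v : linear_form v \is 1.-homog.
Proof. by apply: rpred_sum => j _; apply: rpredZ; rewrite dhomogX /= mdeg1. Qed.

Lemma dehomog_linear_form v :
  dehomog (linear_form v) =
  ((v 0)%:P)%:P * 'X + (v 1 *: 'X + (v (inord 2))%:P)%:P.
Proof.
have e2 : lift ord0 (lift ord0 ord0) = inord 2 :> 'I_3.
  by apply: val_inj; rewrite /= inordK.
have e1 : lift ord0 ord0 = 1 :> 'I_3 by apply: val_inj.
rewrite rmorph_sum /= !big_ord_recl big_ord0 /= e2 e1 !dehomogZ !dehomogX.
rewrite /triple !(tnth_nth 0) /= inordK //= addr0 mulr1.
by rewrite polyCD -mul_polyC polyCM.
Qed.

Lemma evalxy_affine k (q : {poly K}) :
  evalxy x ((k%:P)%:P * 'X + q%:P) = emb k%:P * x + emb q.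
Proof. by rewrite evalxyE rmorphD rmorphM /= map_polyX !map_polyC !hornerE. Qed.

(** As [q] is affine in y, the left side is a linear form at the generic point, and C is not a
    line. *)
Lemma affine_eq0 k (q : {poly K}) : (size q <= 2)%N ->
  emb k%:P * x + emb q = 0 -> k = 0 /\ q = 0.
Proof.
move=> sq; rewrite -evalxy_affine.
pose v := triple k q`_1 q`_0.
have eq : q = q`_1 *: 'X + (q`_0)%:P.
  apply/polyP => i; rewrite !coefE; case: i => [|[|i]] /=.
  - by rewrite mulr0 add0r.
  - by rewrite mulr1 addr0.
  - by rewrite mulr0 addr0 nth_default // (leq_trans sq).
have ev : (k%:P)%:P * 'X + q%:P = dehomog (linear_form v).
  by rewrite dehomog_linear_form /v /triple !(tnth_nth 0) /= inordK //= -eq.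
rewrite ev => v0.
have d1 : (1 < d)%N by apply: ltnW.
have L0 := generic_form_eq0 genF Fd (linear_form_homog v) d1 v0.
have e0 : (k%:P)%:P * 'X + q%:P = 0 by rewrite ev L0 rmorph0.
have := congr1 (fun p : {poly {poly K}} => p`_1) e0.
have := congr1 (fun p : {poly {poly K}} => p`_0) e0.
rewrite !coefE /= mulr0 add0r mulr1 addr0 => -> /eqP.
by rewrite polyC_eq0 => /eqP->.
Qed.

Lemma affine_inj k k' (q q' : {poly K}) : (size q <= 2)%N -> (size q' <= 2)%N ->
  emb k%:P * x + emb q = emb k'%:P * x + emb q' -> k = k' /\ q = q'.
Proof.
move=> sq sq' /eqP; rewrite -subr_eq0 opprD addrACA -mulrBl.
rewrite -!(rmorphB emb) -(rmorphB (@polyC K)) /=.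
move=> /eqP /affine_eq0[|/eqP + /eqP]; last by rewrite !subr_eq0 => /eqP-> /eqP->.
by apply: leq_trans (size_polyD _ _) _; rewrite size_polyN geq_max sq.
Qed.

Lemma val_linear_form v :
  vsval (\sum_(j < 3) cstC x (v j) * hcoordC x j) =
  evalxy x (dehomog (linear_form v)).
Proof.
rewrite /linear_form (rmorph_sum (@dehomog K)) raddf_sum rmorph_sum /=.
apply: eq_bigr => j _; rewrite dehomogZ (rmorphM (evalxy x)) dehomogX /= algid1.
have -> : evalxy x ((v j)%:P)%:P = (cstP1 (v j))%:A.
  by rewrite evalxyE map_polyC hornerC.
congr (_ * _); rewrite /hcoordC /triple !(tnth_nth 0).
case: j => [[|[|[|//]]] ?] /=.
- by rewrite val_vx evalxyE map_polyX hornerX.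
- by rewrite algid1 evalxyE map_polyC hornerC.
- by rewrite algid1 rmorph1.
Qed.

Lemma dehomog_minor (L1 L2 : {mpoly K[3]}) :
  dehomog ('X_(inord 2) * L1 - 'X_1 * L2) = dehomog L1 - ('X)%:P * dehomog L2.
Proof.
rewrite rmorphD rmorphN !rmorphM /= !dehomogX /triple !(tnth_nth 0).
by rewrite inordK //= mul1r.
Qed.

Lemma evalxy_minor (g h : {poly {poly K}}) :
  evalxy x (g - ('X)%:P * h) = evalxy x g - (yP1 K)%:A * evalxy x h.
Proof.
rewrite rmorphD rmorphN rmorphM /=; congr (_ - _ * _).
by rewrite evalxyE map_polyC hornerC.
Qed.

(** The hypothesis says that the quadratic form [G] vanishes at the generic point. Since 2 < [d],
    [G] is zero, and its coefficients give the five equations. *)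
Lemma fiber_linear_shape (A : 'M[K]_3) :
  evalxy x (dehomog (linear_form (A 1))) =
    (yP1 K)%:A * evalxy x (dehomog (linear_form (A (inord 2)))) ->
  [/\ A 1 0 = 0, A (inord 2) 0 = 0, A (inord 2) 1 = 0,
      A 1 (inord 2) = 0 & A 1 1 = A (inord 2) (inord 2)].
Proof.
move=> e.
pose G := 'X_(inord 2) * linear_form (A 1) - 'X_1 * linear_form (A (inord 2)).
have G2 : G \is 2.-homog.
  by apply: rpredB; rewrite -[2%N]/(1 + 1)%N
    dhomogM ?linear_form_homog // dhomogX /= mdeg1.
have eG : dehomog G = dehomog (linear_form (A 1)) -
    ('X)%:P * dehomog (linear_form (A (inord 2))) by exact: dehomog_minor.
have : evalxy x (dehomog G) = 0.
  by rewrite eG evalxy_minor e subrr.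
move/(generic_form_eq0 genF Fd G2 d3) => G0.
move: eG; rewrite G0 rmorph0 => /esym/eqP; rewrite subr_eq0 !dehomog_linear_form.
move=> /eqP e0.
have e1 := congr1 (fun p : {poly {poly K}} => p`_1) e0.
have {}e0 := congr1 (fun p : {poly {poly K}} => p`_0) e0.
move: e0 e1; rewrite !coefE /= !mulr0 !add0r !mulr1 !addr0 => e0 e1.
have e10 := congr1 (fun p : {poly K} => p`_0) e1.
have e11 := congr1 (fun p : {poly K} => p`_1) e1.
have e00 := congr1 (fun p : {poly K} => p`_0) e0.
have e01 := congr1 (fun p : {poly K} => p`_1) e0.
have e02 := congr1 (fun p : {poly K} => p`_2) e0.
move: e10 e11 e00 e01 e02.
rewrite !coefE /= ?mulr0 ?add0r ?mulr1 ?addr0 ?mul1r ?mul0r.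
by move=> -> <- -> -> <-.
Qed.

(** Fixing y makes the last two rows of [A] a multiple [m] of those of the identity, so the scale
    factor is the constant [m^-1]; the first row divided by [m] gives [a] and [q]. *)
Lemma G0P_affine t : G0P x t -> exists (a : K) (q : {poly K}),
  [/\ a != 0, (size q <= 2)%N & vsval (t vx) = emb a%:P * x + emb q].
Proof.
move=> [[tB ty] [A uA [l l0 el]]].
have [s [es _ _]] := tB.
have e2 : l * \sum_(j < 3) cstC x (A (inord 2) j) * hcoordC x j = 1.
  by rewrite -el /hcoordC /triple (tnth_nth 0) /= inordK //= es rmorph1.
have e1 : l * \sum_(j < 3) cstC x (A 1 j) * hcoordC x j = (yP1 K)%:A.
  by rewrite -el /hcoordC /triple (tnth_nth 0) /= ty.
have := el 0; rewrite {1}/hcoordC {1}/triple (tnth_nth 0) /= => e0.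
have vL v z : z = l * \sum_(j < 3) cstC x (v j) * hcoordC x j ->
    vsval z = vsval l * evalxy x (dehomog (linear_form v)).
  by move=> ->; rewrite -val_linear_form; apply: (rmorphM vsval).
move: (vL _ _ (esym e2)) (vL _ _ (esym e1)) (vL _ _ e0) => {}e2 {}e1 {}e0.
move: e2 e1 e0; rewrite /= algid1 => e2 e1 e0.
have l'0 : vsval l != 0 by [].
have [] := @fiber_linear_shape A.
  by apply: (mulfI l'0); rewrite mulrCA -e2 mulr1 -e1.
move=> a10 a20 a21 a12 a11.
move: e2; rewrite dehomog_linear_form a20 a21 rmorph0 scale0r mul0r !add0r.
rewrite evalxyE map_polyC hornerC => e2.
have a22 : A (inord 2) (inord 2) != 0.
  apply/eqP => m0; move/eqP: e2.
  by rewrite m0 polyC0 /= rmorph0 scale0r mulr0 oner_eq0.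
set m := A (inord 2) (inord 2) in e2 a22 *.
have le : vsval l = emb (m^-1)%:P.
  by apply: (mulIf (x := emb m%:P)); rewrite -?e2 -?rmorphM -?polyCM ?mulVf ?rmorph1
    // fmorph_eq0 tofrac_eq0 polyC_eq0.
exists (m^-1 * A 0 0), (m^-1 *: (A 0 1 *: 'X + (A 0 (inord 2))%:P)); split.
(* If [A 0 0] were 0, the whole first column of [A] would vanish. *)
- rewrite mulf_neq0 ?invr_eq0 //; apply: contraTneq uA => a00.
  rewrite unitmxE (expand_det_col _ 0) big1 ?unitr0 // => i _.
  suff -> : A i 0 = 0 by rewrite mul0r.
  case: i => [[|[|[|//]]] Hi].
  + by rewrite -a00; congr (A _ _); apply: val_inj.
  + by rewrite -a10; congr (A _ _); apply: val_inj.
  + by rewrite -a20; congr (A _ _); apply: val_inj; rewrite /= inordK.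
- apply: leq_trans (size_scale_leq _ _) _.
  apply: leq_trans (size_polyD _ _) _; rewrite geq_max.
  rewrite (leq_trans (size_scale_leq _ _)) ?size_polyX //=.
  exact: leq_trans (size_polyC_leq1 _) _.
rewrite e0 le dehomog_linear_form evalxy_affine mulrDr mulrA -!rmorphM.
by rewrite -(mul_polyC m^-1).
Qed.

(** Since [s] fixes the constants, the matrices multiply in the reverse order of the pullbacks. *)
Lemma G0P_comp s t : G0P x s -> G0P x t -> G0P x (s \o t).
Proof.
move=> [[[rs [-> sB sK]] sy] [A uA [l l0 el]]].
move=> [[[rt [-> tB tK]] ty] [B uB [m m0 em]]].
split; first split.
- exists (rs \o rt); split=> //; first exact: bij_comp.
  by move=> k; rewrite /= tK sK.
- by move=> a; rewrite /= ty sy.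
exists (B *m A); first by rewrite unitmx_mul uB.
exists (rs m * l); first by rewrite mulf_neq0 ?fmorph_eq0.
move=> i; rewrite /= em rmorphM rmorph_sum -mulrA; congr (_ * _).
have rsE j : rs (cstC x (B i j) * hcoordC x j) =
    l * \sum_k cstC x (B i j) * (cstC x (A j k) * hcoordC x k).
  by rewrite (rmorphM rs) /= el sK mulrCA mulr_sumr.
rewrite (eq_bigr _ (fun j _ => rsE j)) -mulr_sumr exchange_big /=.
congr (_ * _); apply: eq_bigr => j _.
under eq_bigr => k _ do rewrite mulrA.
rewrite -mulr_suml mxE; congr (_ * _).
rewrite /cstC /cstP1 !rmorph_sum scaler_suml; apply: eq_bigr => k _.
by rewrite !rmorphM -scalerAl mul1r scalerA.
Qed.

Lemma KC_horner (w : KCtype x) :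
  exists p, w = (map_poly (GRing.in_alg (KCtype x)) p).[vx].
Proof.
have /Fadjoin_polyP[p /polyOver1P[q ->] ew] := subvsP w.
exists q; apply: val_inj; rewrite /= ew -horner_map -map_poly_comp /=.
rewrite val_vx; congr (_.[_]); apply: eq_map_poly => a /=.
by rewrite algid1.
Qed.

Lemma GP_bir_horner t p : GP_bir x t ->
  t (map_poly (GRing.in_alg (KCtype x)) p).[vx] =
  (map_poly (GRing.in_alg (KCtype x)) p).[t vx].
Proof.
move=> [[s [-> _ _]] ty]; rewrite -horner_map -map_poly_comp.
by congr (_.[_]); apply: eq_map_poly => a; apply: ty.
Qed.

Lemma GP_bir_eq s t : GP_bir x s -> GP_bir x t -> s vx = t vx -> s = t.
Proof.
move=> Gs Gt e; apply: funext => w; have [p ->] := KC_horner w.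
by rewrite !GP_bir_horner // e.
Qed.

(** [t] fixes K(y), so applying it to a relation at the generic point substitutes the image of x for
    x. *)
Lemma evalxy_subst t (a : K) (q : {poly K}) g : GP_bir x t ->
  vsval (t vx) = emb a%:P * x + emb q ->
  evalxy x g = 0 -> evalxy x (g \Po ((a%:P)%:P * 'X + q%:P)) = 0.
Proof.
move=> Gt et.
pose h := map_poly (@FracField.tofrac {poly K}) g.
have ev (w : KCtype x) :
    vsval (map_poly (GRing.in_alg (KCtype x)) h).[w] = (map_poly emb g).[vsval w].
  rewrite -horner_map -map_poly_comp -map_poly_comp; congr (_.[_]).
  by apply: eq_map_poly => b; rewrite /= algid1.
rewrite [in X in _ -> X]evalxyE map_comp_poly horner_comp.
rewrite -(evalxyE x) evalxy_affine -et.
rewrite evalxyE -{1}val_vx -!ev -GP_bir_horner //.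
move=> /(congr1 (vsproj (KC x))); rewrite vsvalK raddf0 => ->.
by have [[s [-> _ _]] _] := Gt; rewrite rmorph0.
Qed.

End Homologies.

(** * The common axis and the equation in powers of x1 *)

Section CommonAxis.
Variables (K : fieldType) (M : fieldExtType (KP1 K)) (x : M) (F : {mpoly K[3]}).
Variables d n : nat.
Hypotheses (genF : generic_point x F) (Fd : F \is d.-homog) (d3 : (2 < d)%N).
Hypotheses (charK : [pchar K] =i pred0) (n2 : (1 < n)%N).
Hypothesis cardG : (G0P x #= `I_n)%card.

Local Notation emb := (GRing.in_alg M \o @FracField.tofrac {poly K}).
Local Notation vx := (vsproj (KC x) x : KCtype x).

Lemma GP_bir_affine s w (a q : {poly K}) : GP_bir x s ->
  vsval w = emb a * x + emb q -> vsval (s w) = emb a * vsval (s vx) + emb q.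
Proof.
move=> [[rs [-> _ _]] sy] ew.
have -> : w = (FracField.tofrac a)%:A * vx + (FracField.tofrac q)%:A.
  by apply: val_inj; rewrite /= ew !algid1 val_vx.
rewrite (rmorphD rs) (rmorphM rs) /= !sy.
by rewrite /= !algid1.
Qed.

(** Indexing the group by ['I_n] makes sums and products over it available. *)
Lemma enum_G0P : exists g : 'I_n -> KCtype x -> KCtype x,
  [/\ injective g, forall i, G0P x (g i) & forall t, G0P x t -> exists i, t = g i].
Proof.
have /card_set_bijP[f [funf injf surjf]] := cardG.
have ex (i : 'I_n) : exists t, G0P x t /\ f t = i.
  by have [t Gt ft] := surjf i (ltn_ord i); exists t.
have [g gP] := choice ex.
exists g; split.
- by move=> i j e; apply: val_inj; rewrite /= -(gP i).2 -(gP j).2 e.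
- by move=> i; exact: (gP i).1.
move=> t Gt; exists (Ordinal (funf t Gt)); apply: injf; rewrite ?inE //.
  exact: (gP _).1.
by rewrite (gP _).2.
Qed.

(* Comparing (g i \o g j)(x) with the average over i gives
   q_j = (1 - a_j) n^-1 \sum_i q_i: all homologies share the axis
   x - n^-1 \sum_i q_i(y) = 0. *)
Lemma common_axis : exists (z : K) (Q : {poly K}) (t : KCtype x -> KCtype x),
  [/\ n.-primitive_root z, (size Q <= 2)%N, GP_bir x t &
      vsval (t vx) = emb z%:P * x + emb (z *: Q - Q)].
Proof.
have [g [g_inj gG gsurj]] := enum_G0P.
have n0 : n%:R != 0 :> K.
  by have /pcharf0P-> := charK; rewrite -lt0n ltnW.
have [a aP] := choice (fun i => G0P_affine genF Fd d3 (gG i)).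
have [q wP] := choice aP.
have a0 i : a i != 0 by have [] := wP i.
have q2 i : (size (q i) <= 2)%N by have [] := wP i.
have gx i : vsval (g i vx) = emb (a i)%:P * x + emb (q i) by have [] := wP i.
have [h hP] := choice (fun ij : 'I_n * 'I_n => gsurj _ (G0P_comp (gG ij.1) (gG ij.2))).
(* [h] is the multiplication table; right translation by [g j] permutes the indices, so sums and
   products can be reindexed along it. *)
have h_inj j : injective (fun i => h (i, j)).
  move=> i i' /= e; apply: g_inj; have := hP (i, j); have := hP (i', j).
  rewrite /= e => <- ee; have [[[s [_ [gj' _ gjK] _]] _] _] := gG j.
  by apply: funext => u; rewrite -(gjK u); have := congr1 (fun f => f (gj' u)) ee.
have hx i j : a (h (i, j)) = a j * a i /\ q (h (i, j)) = a j *: q i + q j.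
  apply: (affine_inj genF Fd d3) => //.
    apply: leq_trans (size_polyD _ _) _; rewrite geq_max q2 andbT.
    exact: leq_trans (size_scale_leq _ _) _.
  rewrite -gx -hP -[X in vsval X = _]/(g i (g j vx)) (GP_bir_affine (gG i).1 (gx j)) gx.
  rewrite (rmorphD emb) -mul_polyC polyCM !(rmorphM emb) mulrDr !mulrA addrA.
  by [].
set B := \sum_i q i.
have qE j : q j = (1 - a j) *: (n%:R^-1 *: B).
  have : B = \sum_i q (h (i, j)) by rewrite /B (reindex_inj (h_inj j)).
  rewrite (eq_bigr _ (fun i _ => (hx i j).2)) big_split /= -scaler_sumr sumr_const.
  rewrite card_ord -/B => eB.
  have qn : q j *+ n = (1 - a j) *: B.
    by rewrite scalerBl scale1r {1}eB addrAC subrr add0r.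
  by rewrite scalerA mulrC -scalerA -qn -scaler_nat scalerA mulVf ?scale1r.
(* By [qE] the factor [a j] determines [q j], hence the image of x, hence [g j]. *)
have a_inj : injective a.
  move=> i j e; apply: g_inj; apply: (@GP_bir_eq _ _ _ (g i) (g j)).
  - by have [] := gG i.
  - by have [] := gG j.
  by apply: val_inj; rewrite /= !gx !qE e.
(* Right translation by [g j] multiplies each factor of the product of all [a i] by [a j] and leaves
   the product unchanged. *)
have an j : a j ^+ n = 1.
  have prod0 : \prod_i a i != 0 by apply/prodf_neq0.
  apply: (mulIf prod0); rewrite mul1r [RHS](reindex_inj (h_inj j)) /=.
  rewrite (eq_bigr _ (fun i _ => (hx i j).1)) big_split /= prodr_const.
  by rewrite card_ord.
(* The [a i] are [n] distinct n-th roots of unity, so one of them is primitive. *)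
have /hasP[z /codomP[j ->] zn] : has n.-primitive_root (codom a).
  apply: has_prim_root; first exact: ltnW.
  - by apply/allP => _ /codomP[i ->]; apply/unity_rootP; apply: an.
  - by apply/injectiveP.
  by rewrite size_codom card_ord.
exists (a j), (- (n%:R^-1 *: B)), (g j); split=> //.
- rewrite size_polyN; apply: leq_trans (size_scale_leq _ _) _.
  by apply: leq_trans (size_sum _ _ _) _; apply/bigmax_leqP => i _; apply: q2.
- by have [] := gG j.
by rewrite gx qE scalerN opprK scalerBl scale1r [- _ + _]addrC.
Qed.

(* The conjugate of dehomog F by t is proportional to it because the degree of
   x is that of dehomog F, so in the coordinate x + Q only powers
   of exponent congruent to the degree occur; the constant term is nonzero. *)
Lemma given_by_common_axis : exists b c f, given_by F b c n f.
Proof.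
have [z [Q [t [zn Q2 Gt tx]]]] := common_axis.
have Px := evalxy_dehomog0 genF Fd.
pose A := 'X + Q%:P : {poly {poly K}}.
(* The equation of C rewritten in the coordinate x + Q, which [t] multiplies by [z]. *)
pose g1 := dehomog F \Po ('X - Q%:P).
have gA : dehomog F = g1 \Po A.
  by rewrite -comp_polyA comp_polyB comp_polyX comp_polyC addrK comp_polyXr.
have sA (g : {poly {poly K}}) : size (g \Po A) = size g.
  by rewrite size_comp_poly2 // size_XaddC.
have g1z i : g1`_i != 0 -> z ^+ i = z ^+ (size g1).-1.
  move=> gi; pose m := (size g1).-1.
  (* The leading terms cancel, so [D] has smaller degree than the equation; as it vanishes at the
     generic point, it is 0. *)
  pose D := g1 \Po ((z%:P)%:P * 'X) - ((z ^+ m)%:P)%:P * g1.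
  have Dc k : D`_k = (z ^+ k - z ^+ m)%:P * g1`_k.
    rewrite /D coefB coefCM polyCB mulrBl; congr (_ - _).
    rewrite comp_polyE; under eq_bigr => l _ do
      rewrite exprMn -!rmorphXn mul_polyC scalerA.
    rewrite -(poly_def _ (fun i => g1`_i * (z ^+ i)%:P)) coef_poly mulrC.
    by case: ltnP => // le_k; rewrite nth_default ?mulr0.
  have D0 : D = 0.
    apply/eqP; rewrite -size_poly_eq0 -sA size_poly_eq0; apply: contraT => DA0.
    have /(evalxy_size genF)/(_ DA0) : evalxy x (D \Po A) = 0.
      have := evalxy_subst Gt tx Px; rewrite gA -comp_polyA.
      have -> : A \Po ((z%:P)%:P * 'X + (z *: Q - Q)%:P) = (z%:P)%:P * A.
        rewrite comp_polyD comp_polyX comp_polyC -addrA -polyCD subrK.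
        by rewrite /A mulrDr -(mul_polyC z) polyCM.
      have -> : (z%:P)%:P * A = ((z%:P)%:P * 'X) \Po A.
        by rewrite comp_polyM comp_polyC comp_polyX.
      rewrite comp_polyA => e; rewrite /D comp_polyB comp_polyM comp_polyC -gA.
      by rewrite rmorphD rmorphN rmorphM /= e Px mulr0 subr0.
    rewrite sA gA sA => leg; have g1_gt0 : (0 < size g1)%N.
      by rewrite size_poly_gt0; apply: contraNneq gi => ->; rewrite coef0.
    have : (size D <= m)%N.
      apply/leq_sizeP => k; rewrite leq_eqVlt => /orP[/eqP <-|mk].
        by rewrite Dc subrr mul0r.
      by rewrite Dc [g1`_k]nth_default ?mulr0 // -(prednK g1_gt0).
    by move=> /(leq_trans leg); rewrite -{1}(prednK g1_gt0) ltnn.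
  apply/eqP; rewrite -subr_eq0 -polyC_eq0.
  have /eqP := Dc i; rewrite D0 coef0 eq_sym mulf_eq0 (negPf gi) orbF //.
(* Otherwise x + Q would divide the equation, and either x + Q or the cofactor, of smaller degree,
   would vanish at the generic point. *)
have g10 : g1`_0 != 0.
  apply/negP; rewrite -horner_coef0 => /factor_theorem[h].
  rewrite subr0 => eh.
  have h0 : h != 0.
    by apply: contraNneq (dehomog_neq0 genF) => h0; rewrite gA eh h0 mul0r comp_poly0.
  have /eqP := Px; rewrite gA eh comp_polyM comp_polyX rmorphM mulf_eq0 /=.
  case/orP => /eqP.
    move=> /(evalxy_size genF); rewrite -size_poly_eq0 sA size_poly_eq0 => /(_ h0).
    by rewrite gA sA eh size_mulX // ltnn.
  rewrite /A -['X]mul1r evalxy_affine => /(affine_eq0 genF Fd d3 Q2)[/eqP].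
  by rewrite oner_eq0.
(* Exponent 0 occurs, so [z ^+ i] is 1 for every exponent [i] that occurs. *)
have g1n i : ~~ (n %| i)%N -> g1`_i = 0.
  apply: contraNeq => /g1z; rewrite -(g1z 0%N g10) expr0 => /eqP.
  by rewrite (prim_order_dvd zn).
(* [f] keeps the coefficients at multiples of [n]; the bound [size g1] is generous, and coefficients
   beyond the degree read as 0. *)
exists Q`_1, Q`_0, (\poly_(i < size g1) g1`_(i * n)).
exists 1; rewrite ?oner_eq0 // !rmorph1 mul1r.
have -> : Q`_1 *: 'X + (Q`_0)%:P = Q.
  apply/polyP => i; rewrite !coefE; case: i => [|[|i]] /=.
  - by rewrite mulr0 add0r.
  - by rewrite mulr1 addr0.
  - by rewrite mulr0 addr0 nth_default // (leq_trans Q2).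
rewrite gA -/A -[A ^+ n]comp_Xn_poly comp_polyA; congr (_ \Po _).
apply/polyP => i; rewrite coef_comp_poly_Xn ?(ltnW n2) //.
case: ifPn => [/dvdnP[k ->]|/g1n //]; rewrite mulnK ?(ltnW n2) // coef_poly.
case: ltnP => // le_k; rewrite nth_default //.
by apply: leq_trans le_k _; rewrite leq_pmulr // ltnW.
Qed.
End CommonAxis.

Local Close Scope ring_scope.

Theorem proposition3p9 (K : closedFieldType) (d n : nat) (F : {mpoly K[3]})
    (M : splittingFieldType (KP1 K)) (x : M) (LP : {subfield M}) :
  ([pchar K] =i pred0)%R ->
  (4 <= d)%N ->
  plane_curve d F ->
  generic_point x F ->
  is_galois_closure (KC x) LP ->
  (2 <= n)%N ->
  (G0P x #= `I_n)%card ->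
  (exists (b c : K) (f : {poly {poly K}}), given_by F b c n f) /\
  (forall (b c : K) (f : {poly {poly K}}) (N : {subfield M}),
     given_by F b c n f ->
     is_galois_closure (KXy x b c n) N ->
     let r := (size f).-1 in
     let R := \dim N in
     (n * r <= #|'Gal(LP / 1)%g| <= R * n ^ r)%N /\
     (n <= #|'Gal(LP / 1)%g| <= r`! * n ^ r)%N).
Proof.
move=> charK d4 [Fd _] genF clL n2 cardG; split.
  exact: given_by_common_axis genF Fd (ltnW d4) charK n2 cardG.
move=> b c f N gF clN r R.
have [r0 leR bounds] := degree_bounds charK Fd genF (ltnW n2) clL gF clN.
split=> //; have /andP[lo hi] := bounds; apply/andP; split.
  by apply: leq_trans lo; rewrite leq_pmulr.
by apply: leq_trans hi _; rewrite leq_mul2r leR orbT.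
Qed.
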